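(* Let $p$ be a prime and $e$ an integer with $1\le e<p$. Then there are infinitely many distinct $c\in\mathbb{C}$ such that the correspondence on $\mathbb{A}^1$ defined by $y^e=x^p+c$ is postcritically constrained.
   Context: For polynomials $f,g\in\mathbb{C}[z]$ with $\deg f>\deg g\ge1$, the correspondence $g(y)=f(x)$ is $C=\{(a,b)\in\mathbb{C}^2:g(b)=f(a)\}$. A critical point is $a$ with $f'(a)=0$ or $g'(b)=0$ for some $b$ with $g(b)=f(a)$. A path is a sequence $(x_n)_{n\ge0}$ with $(x_n,x_{n+1})\in C$ for all $n$, starting at $x_0$; it is preperiodic if $(x_{n+j})_{j\ge0}=(x_{m+j})_{j\ge0}$ for some $n\ne m$. $C$ is postcritically constrained if every critical point starts at least one preperiodic path. *)

(* Defs.v *)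
(* The complex field C is modelled by an arbitrary
   numClosedFieldType (algebraically closed numeric field; ℂ is one). *)
From HB Require Import structures.
From mathcomp Require Import all_boot all_order all_algebra.
Set Implicit Arguments. Unset Strict Implicit. Unset Printing Implicit Defensive.
Import Order.TTheory GRing.Theory Num.Theory.
Local Open Scope ring_scope.

Section Corr.
Variable C : numClosedFieldType.

Definition in_corr (f g : {poly C}) (a b : C) : Prop := g.[b] = f.[a].

Definition critical_pt (f g : {poly C}) (a : C) : Prop :=
  f^`().[a] = 0 \/ exists b, in_corr f g a b /\ g^`().[b] = 0.

Definition is_corr_path (f g : {poly C}) (x : nat -> C) : Prop :=
  forall n, in_corr f g (x n) (x n.+1).

Definition preperiodic_seq (x : nat -> C) : Prop :=
  exists n m : nat, n <> m /\ forall j, x (n + j)%N = x (m + j)%N.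

Definition postcritically_constrained (f g : {poly C}) : Prop :=
  forall a, critical_pt f g a ->
    exists x : nat -> C, x 0%N = a /\ is_corr_path f g x /\ preperiodic_seq x.

End Corr.

(* Main.v *)
(** Every c for which 0 lies on a cycle of the correspondence is postcritically
    constrained, since a critical point is 0 or has 0 as its only image.  Taking
    norms along the backward p-valued branches, such c for cycles of length n are
    the roots of a polynomial P_n in Z[c].  Modulo p the backward map becomes
    single-valued up to Frobenius, and P_n reduces to A_n with A_0 = 0 and
    A_(n+1) = A_n^e - c^(p^n).  This has degree p^(n-1), while
    A_(n+1)' = e A_n^(e-1) A_n' bounds the multiplicity of every root by e^(n-1).
    As e < p, the number of distinct roots of the reductions is unbounded.  If
    all P_n had their complex roots in a finite set, then all P_n would divide
    powers of a single D in Z[c] that is nonzero mod p, a contradiction. *)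

Require Import Defs.
From HB Require Import structures.
From mathcomp Require Import all_boot all_order all_algebra all_field.
From mathcomp Require Import zify.
From Stdlib Require Import Classical_Prop.
Import GRing.Theory Num.Theory.
Local Open Scope ring_scope.
Set Implicit Arguments.
Unset Strict Implicit.
Unset Printing Implicit Defensive.

Lemma pFrobenius_inj (R : idomainType) p (pR : p \in [pchar R]) :
  injective (pFrobenius_aut pR).
Proof.
move=> x y /eqP; rewrite -subr_eq0 -rmorphB /= pFrobenius_autE expf_eq0.
by rewrite subr_eq0 => /andP[_ /eqP].
Qed.

Lemma detX (R : comNzRingType) n (A : 'M[R]_n.+1) k : \det (A ^+ k) = \det A ^+ k.
Proof. by elim: k => [|k IHk]; rewrite ?det1 // !exprS det_mulmx IHk. Qed.

(** * Norms from adjoining an [m.+1]-th root *)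

Section RootNorm.
Variable m : nat.

(** The companion matrix of [X^(m+1) - v]. *)
Definition root_mx (R : comNzRingType) (v : R) : 'M[R]_m.+1 :=
  \matrix_(i, j) if i == ord_max then v *+ (j == ord0) else (i.+1 == j)%:R.

Lemma map_root_mx (R S : comNzRingType) (f : {rmorphism R -> S}) (v : R) :
  map_mx f (root_mx v) = root_mx (f v).
Proof.
apply/matrixP=> i j; rewrite !mxE.
by case: ifP => _ /=; [rewrite rmorphMn | rewrite rmorph_nat].
Qed.

(** The matrix shifts the basis rows and sends the last to [v] times the first. Thus [d ord0] is
    cyclic, and checking it suffices because powers commute. *)
Lemma root_mxX (R : comNzRingType) (v : R) : root_mx v ^+ m.+1 = v%:M.
Proof.
pose d i : 'rV[R]_m.+1 := delta_mx 0 i.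
have stepE (i : 'I_m.+1) (lt_im : (i.+1 < m.+1)%N) :
    d i *m root_mx v = d (Ordinal lt_im).
  rewrite -rowE; apply/rowP=> j; rewrite !mxE eqxx /=.
  by rewrite -val_eqE /= ltn_eqF // -val_eqE /= eq_sym.
have powE k (lt_km : (k < m.+1)%N) : d ord0 *m root_mx v ^+ k = d (Ordinal lt_km).
  elim: k lt_km => [|k IHk] lt_km.
    by rewrite expr0 mulmx1; congr d; apply: val_inj.
  rewrite exprSr mulmxA (IHk (ltnW lt_km)) (stepE (Ordinal (ltnW lt_km))).
  by congr d; apply: val_inj.
apply/row_matrixP=> i; rewrite !rowE -/(d i).
have -> : i = Ordinal (ltn_ord i) by apply: val_inj.
have -> : d (Ordinal (ltn_ord i)) *m root_mx v ^+ m.+1 =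
    d ord0 *m root_mx v ^+ m.+1 *m root_mx v ^+ i.
  by rewrite -powE -!mulmxA !mulmxE -!exprD addnC.
rewrite -powE mul_mx_scalar scalemxAl; congr (_ *m _).
rewrite exprSr mulmxA (powE m (ltnSn m)) -rowE; apply/rowP=> j.
by rewrite !mxE eqxx -val_eqE /= eqxx mulr_natr.
Qed.

(** The product of [G z] over all [z] with [z ^+ m.+1 = v], multiplicities included. *)
Definition root_norm (R : comNzRingType) (v : R) (G : {poly R}) : R :=
  \det (horner_mx (root_mx v) G).

Lemma map_root_norm (R S : comNzRingType) (f : {rmorphism R -> S}) v G :
  f (root_norm v G) = root_norm (f v) (map_poly f G).
Proof. by rewrite /root_norm -det_map_mx map_horner_mx map_root_mx. Qed.

(** If [G] and ['X ^+ m.+1 - v%:P] were coprime, a Bezout identity evaluated at the matrix would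
    make the norm a divisor of 1. *)
Lemma root_norm_eq0 (F : closedFieldType) (v : F) (G : {poly F}) :
  root_norm v G = 0 -> exists2 z, z ^+ m.+1 = v & root G z.
Proof.
move=> N0; have [cop|] := boolP (coprimep G ('X ^+ m.+1 - v%:P)).
  have /Bezout_eq1_coprimepP[[u w] /= uwE] := cop.
  have : \det (horner_mx (root_mx v) 1) = 0.
    rewrite -uwE rmorphD !rmorphM rmorphB /= rmorphXn /= horner_mx_X horner_mx_C.
    by rewrite root_mxX subrr mulr0 addr0 det_mulmx -/(root_norm v G) N0 mulr0.
  by rewrite rmorph1 det1 => /eqP; rewrite oner_eq0.
rewrite /coprimep => /closed_rootP[z]; rewrite root_gcd => /andP[Gz].
rewrite rootE !hornerE subr_eq0 => /eqP zE; by exists z.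
Qed.

(** [G ^+ m.+1] is the Frobenius twist of [G] in ['X ^+ m.+1], hence scalar at the matrix.
    Determinants equate the [m.+1]-th powers of both sides, and Frobenius is injective. *)
Lemma root_norm_pchar (R : idomainType) (pR : m.+1 \in [pchar R]) (v : R) G :
  root_norm v G = (map_poly (pFrobenius_aut pR) G).[v].
Proof.
have powE : G ^+ m.+1 = map_poly (pFrobenius_aut pR) G \Po 'X ^+ m.+1.
  have pP : m.+1 \in [pchar {poly R}] by rewrite pchar_poly.
  elim/poly_ind: G => [|G c IHG]; first by rewrite map_poly0 comp_poly0 expr0n.
  rewrite -(pFrobenius_autE pP) rmorphD rmorphM /= !pFrobenius_autE IHG.
  rewrite rmorphD rmorphM /= map_polyX map_polyC /= comp_polyD comp_polyM.
  by rewrite comp_polyX comp_polyC pFrobenius_autE polyC_exp.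
have detE : root_norm v G ^+ m.+1 = (map_poly (pFrobenius_aut pR) G).[v] ^+ m.+1.
  have comE (H : {poly R}) :
      horner_mx (root_mx v) (H \Po 'X ^+ m.+1) = (H.[v])%:M.
    elim/poly_ind: H => [|H c IHH].
      by rewrite comp_poly0 horner0 !rmorph0.
    rewrite comp_polyD comp_polyM comp_polyX comp_polyC rmorphD rmorphM /= IHH.
    rewrite rmorphXn /= horner_mx_X root_mxX horner_mx_C -rmorphM -rmorphD /=.
    by rewrite !hornerE.
  by rewrite /root_norm -detX -rmorphXn /= powE comE det_scalar.
by apply: (@pFrobenius_inj _ _ pR); rewrite !pFrobenius_autE.
Qed.
End RootNorm.

(** * Norms along backward paths *)

Section ReturnNorm.
Variables m e : nat.

(** At [y], this is the product of [G z] over the [m.+1] preimages [z] of [y]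
    under the correspondence [y ^+ e = z ^+ m.+1 + c]. *)
Definition pullback_norm (R : comNzRingType) (c : R) (G : {poly R}) : {poly R} :=
  root_norm m ('X^e - c%:P) (map_poly polyC G).

(** The product of all ends of backward paths of length [n] from 0; as a
    polynomial in [c], its roots are the [c] for which 0 lies on an [n]-cycle. *)
Definition return_norm (R : comNzRingType) (c : R) n : R :=
  (iter n (pullback_norm c) 'X).[0].

Lemma map_pullback_norm (R S : comNzRingType) (f : {rmorphism R -> S}) c G :
  map_poly f (pullback_norm c G) = pullback_norm (f c) (map_poly f G).
Proof.
rewrite /pullback_norm map_root_norm rmorphB /= map_polyXn map_polyC /=.
rewrite -!map_poly_comp; congr root_norm.
by apply: eq_map_poly => x /=; rewrite map_polyC.
Qed.

Lemma map_return_norm (R S : comNzRingType) (f : {rmorphism R -> S}) c n :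
  f (return_norm c n) = return_norm (f c) n.
Proof.
rewrite /return_norm -horner_map rmorph0; congr _.[_].
by elim: n => [|n IHn]; rewrite ?map_polyX //= map_pullback_norm IHn.
Qed.

Lemma return_norm_eq0 (F : closedFieldType) (c : F) n : return_norm c n = 0 ->
  exists z : nat -> F, [/\ z 0%N = 0, z n = 0 &
    forall k, (k < n)%N -> z k ^+ e = z k.+1 ^+ m.+1 + c].
Proof.
(* Only the starting point of the backward path is generalized to [y]; its end stays 0. *)
rewrite /return_norm; move: {1 3}0 => y; elim: n y => [|n IHn] y.
  by rewrite hornerX => ->; exists (fun=> 0); split.
rewrite iterS /pullback_norm -horner_evalE map_root_norm.
case/root_norm_eq0=> z zE.
rewrite -map_poly_comp map_poly_id => [|x _] /=; last by rewrite horner_evalE hornerC.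
move=> /eqP/IHn[w [w0 wn wE]].
exists (fun k => if k is k'.+1 then w k' else y); split=> // -[_|k /wE //].
by rewrite w0 zE /= horner_evalE !hornerE subrK.
Qed.

Lemma pullback_norm_pchar (R : idomainType) (pR : m.+1 \in [pchar R]) (c : R) G :
  pullback_norm c G = map_poly (pFrobenius_aut pR) G \Po ('X^e - c%:P).
Proof.
have pP : m.+1 \in [pchar {poly R}] by rewrite pchar_poly.
rewrite /pullback_norm (root_norm_pchar pP) /comp_poly -!map_poly_comp.
congr _.[_]; apply: eq_map_poly => x /=.
by rewrite !pFrobenius_autE -polyC_exp.
Qed.

Lemma return_normS_pchar (R : idomainType) (pR : m.+1 \in [pchar R]) (c : R) n :
  return_norm c n.+1 = return_norm c n ^+ e - c ^+ (m.+1 ^ n).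
Proof.
rewrite /return_norm.
(* The recursion holds before evaluation at 0, since in this characteristic the pullback is a ring
   morphism raising constants to the power [m.+1]. *)
suff -> : iter n.+1 (pullback_norm c) 'X =
    iter n (pullback_norm c) 'X ^+ e - (c ^+ (m.+1 ^ n))%:P by rewrite !hornerE.
elim: n => [|n IHn].
  by rewrite /= (pullback_norm_pchar pR) map_polyX comp_polyX.
rewrite iterS {1}IHn [in RHS]iterS !(pullback_norm_pchar pR).
rewrite rmorphB rmorphXn /= map_polyC /= rmorphB /= rmorphXn /= comp_polyC.
by rewrite pFrobenius_autE -exprM -expnSr.
Qed.
End ReturnNorm.

(** * Degree against root multiplicities *)

Section RootCount.

Lemma leq_mup_deriv (F : fieldType) (x : F) (q : {poly F}) :
  q^`() != 0 -> (mup x q <= (mup x q^`()).+1)%N.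
Proof.
move=> dq0; have q0 : q != 0 by apply: contraNneq dq0 => ->; rewrite deriv0.
case kE: (mup x q) => [|k] //; rewrite ltnS mup_geq //.
have /dvdpP[r ->] : ('X - x%:P) ^+ k.+1 %| q by rewrite -mup_geq ?kE.
rewrite derivM deriv_exp /= derivXsubC mul1r.
apply: dvdp_add; first by rewrite exprS mulrA dvdp_mull.
by rewrite mulrnAr -mulrnAl dvdp_mull.
Qed.

Lemma size_leq_count_mem (T : eqType) (r s : seq T) M :
    {subset r <= s} -> (forall x, count_mem x r <= M)%N ->
  (size r <= size s * M)%N.
Proof.
elim: s r => [|a s IHs] r rs rM.
  by case: r rs {rM} => // x r /(_ x (mem_head _ _)).
rewrite mulSn -(count_predC (pred1 a) r) leq_add // -size_filter IHs //.
  by move=> x; rewrite mem_filter => /andP[/= xa /rs]; rewrite inE (negPf xa).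
by move=> x; apply: leq_trans (rM x); rewrite count_filter sub_count // => y /andP[].
Qed.

(** The degree counts roots with repetition, and the distinct ones are among the roots of [D]. *)
Lemma size_leq_mup (F : closedFieldType) (q D : {poly F}) M :
    q != 0 -> D != 0 -> (forall x, root q x -> root D x) ->
    (forall x, mup x q <= M)%N ->
  ((size q).-1 <= (size D).-1 * M)%N.
Proof.
move=> q0 D0 qD qM; have [r qE] := closed_field_poly_normal q.
have lq0 : lead_coef q != 0 by rewrite lead_coef_eq0.
have -> : (size q).-1 = size r by rewrite qE size_scale // size_prod_XsubC.
have countM x : (count_mem x r <= M)%N.
  rewrite -mu_prod_XsubC; apply: leq_trans (qM x).
  by rewrite mup_geq // qE dvdpZr // -mup_geq // monic_neq0 ?monic_prod_XsubC.
have rD : (size (undup r) <= (size D).-1)%N.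
  rewrite -ltnS prednK ?size_poly_gt0 //.
  apply: max_poly_roots; rewrite ?undup_uniq //.
  apply/allP=> x; rewrite mem_undup => xr; apply: qD.
  by rewrite qE rootZ // root_prod_XsubC.
apply: leq_trans (leq_mul rD (leqnn M)).
by apply: size_leq_count_mem => // x; rewrite mem_undup.
Qed.

End RootCount.

(** * Degree and multiplicities in characteristic [m.+1] *)

Section ReturnNormRoots.
Variables (m e : nat) (F : fieldType) (pF : m.+1 \in [pchar F]).
Hypotheses (e_gt0 : (0 < e)%N) (e_ltp : (e < m.+1)%N).

Local Notation A := (return_norm m e ('X : {poly F})).

Let A1 : A 1 = - 'X.
Proof.
have pP : m.+1 \in [pchar {poly F}] by rewrite pchar_poly.
rewrite (return_normS_pchar _ pP) {1}/return_norm /= hornerX expn0 expr0n.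
by rewrite eqn0Ngt e_gt0 sub0r.
Qed.

Lemma size_return_norm n : size (A n.+1) = (m.+1 ^ n).+1.
Proof.
have pP : m.+1 \in [pchar {poly F}] by rewrite pchar_poly.
elim: n => [|n IHn]; first by rewrite A1 size_polyN size_polyX.
rewrite (return_normS_pchar _ pP) addrC size_polyDl size_polyN size_polyXn //.
(* The [e]-th power has degree at most [e * m.+1 ^ n], so the power of ['X] dominates. *)
rewrite ltnS; apply: leq_trans (size_poly_exp_leq _ _) _.
by rewrite IHn /= expnSr ltn_pmul2l // expn_gt0.
Qed.

Lemma return_norm_neq0 n : A n.+1 != 0.
Proof. by rewrite -size_poly_eq0 size_return_norm. Qed.

Lemma deriv_return_norm n : (A n.+2)^`() = (A n.+1)^`() * A n.+1 ^+ e.-1 *+ e.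
Proof.
have pP : m.+1 \in [pchar {poly F}] by rewrite pchar_poly.
rewrite (return_normS_pchar _ pP) derivB deriv_exp derivXn expnS.
by rewrite mulrnA (mulrn_pchar pP) mul0rn subr0.
Qed.

Lemma deriv_return_norm_neq0 n : (A n.+1)^`() != 0.
Proof.
have pP : m.+1 \in [pchar {poly F}] by rewrite pchar_poly.
elim: n => [|n IHn]; first by rewrite A1 derivN derivX oppr_eq0 oner_eq0.
rewrite deriv_return_norm -mulr_natr !mulf_neq0 ?expf_neq0 ?return_norm_neq0 //.
by rewrite -(dvdn_pcharf pP) gtnNdvd.
Qed.

(* By deriv_return_norm, d_n = mup x (A n.+1)^`() + 1 satisfies d_(n+1) <= e d_n. *)
Lemma mup_return_norm x n : (mup x (A n.+1) <= e ^ n)%N.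
Proof.
apply: leq_trans (leq_mup_deriv _ (deriv_return_norm_neq0 n)) _.
elim: n => [|n IHn]; first by rewrite A1 derivN derivX mupNroot // rootN root1.
have An0 := return_norm_neq0 n.
have mupX k : mup x (A n.+1 ^+ k) = (k * mup x (A n.+1))%N.
  elim: k => [|k IHk]; first by rewrite mupNroot // root1.
  by rewrite exprS mupM ?expf_neq0 // IHk.
have dA0 := deriv_return_norm_neq0 n.
have e0 : (e%:R : F) != 0 by rewrite -(dvdn_pcharf pF) gtnNdvd.
rewrite deriv_return_norm -scaler_nat -mul_polyC mupMr ?rootC // mupM ?expf_neq0 //.
rewrite mupX -addSn expnS.
have -> : (e * e ^ n = e ^ n + e.-1 * e ^ n)%N by rewrite -mulSn prednK.
by rewrite leq_add // leq_mul // (leq_trans (leq_mup_deriv x dA0)).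
Qed.
End ReturnNormRoots.

(** * Divisibility over the complex, rational and finite-characteristic fields *)

Section IntPolyReduction.

(** By Gauss, [P] is [a] times an integral divisor [P1] of [D]. The numerator of [a] survives mod
    [p]: otherwise, as [P] is nonzero there, the denominator would vanish too, against
    coprimality. *)
Lemma dvdp_int_pchar (F : fieldType) p (pF : p \in [pchar F]) (P D : {poly int}) :
    map_poly intr P %| (map_poly intr D : {poly rat}) ->
    map_poly intr P != 0 :> {poly F} -> map_poly intr D != 0 :> {poly F} ->
  map_poly intr P %| (map_poly intr D : {poly F}).
Proof.
move=> /dvdpP_rat_int[P1 [a a0 PE] [R DE]] P0 D0.
have denP : denq a *: P = numq a *: P1.
  apply: (map_inj_poly (intr_inj : injective (intr : int -> rat)) (mulr0z _)).
  rewrite !map_polyZ /= PE scalerA; congr (_ *: _).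
  by rewrite -{2}[a]divq_num_den mulrC divfK // intr_eq0 denq_neq0.
have {}denP : (denq a)%:~R *: map_poly intr P = (numq a)%:~R *: map_poly intr P1 :> {poly F}.
  by rewrite -!map_polyZ denP.
rewrite DE rmorphM /= in D0 *; apply: dvdp_mulr.
have P10 : map_poly intr P1 != 0 :> {poly F} by apply: contraNneq D0 => ->; rewrite mul0r.
have [num0|num0] := eqVneq ((numq a)%:~R : F) 0.
  have den0 : (denq a)%:~R = 0 :> F.
    by move/eqP: denP; rewrite num0 scale0r scaler_eq0 (negPf P0) orbF => /eqP.
  have := coprime_num_den a; rewrite /coprime => /eqP g1.
  have /andP[p_pr _] := pF.
  have : (p %| gcdn `|numq a| `|denq a|)%N.
    by rewrite dvdn_gcd -![(p %| `|_|)%N]/(p %| _)%Z !(dvdz_pcharf pF) num0 den0 eqxx.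
  by rewrite g1 dvdn1 => /eqP p1; rewrite p1 in p_pr.
by rewrite -(dvdpZr _ _ num0) -denP -mul_polyC dvdp_mull.
Qed.

(** Over [C] each linear factor of [P] divides [D], so the number of roots of [P] serves as
    exponent; divisibility then descends to the rationals. *)
Lemma dvdp_exp_roots (C : numClosedFieldType) (P D : {poly int}) : P != 0 ->
    (forall c : C, root (map_poly intr P) c -> root (map_poly intr D) c) ->
  exists k, map_poly intr P %| (map_poly intr (D ^+ k) : {poly rat}).
Proof.
move=> P0 PD.
have [r rE] := closed_field_poly_normal (map_poly intr P : {poly C}).
have lP0 : lead_coef (map_poly intr P : {poly C}) != 0.
  by rewrite lead_coef_map_inj //; [rewrite intr_eq0 lead_coef_eq0 | exact: intr_inj].
have rD : {in r, forall c, root (map_poly intr D : {poly C}) c}.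
  by move=> c cr; apply: PD; rewrite rE rootZ // root_prod_XsubC.
have dvdr : \prod_(z <- r) ('X - z%:P) %| (map_poly intr D : {poly C}) ^+ size r.
  elim: r rD {rE} => [|z r IHr] rD; first by rewrite big_nil dvd1p.
  rewrite big_cons exprS dvdp_mul //; first by rewrite dvdp_XsubCl rD ?mem_head.
  by apply: IHr => c cr; rewrite rD // inE cr orbT.
exists (size r).
have ratrE (Q : {poly int}) :
    map_poly (ratr : rat -> C) (map_poly intr Q) = map_poly intr Q.
  by rewrite -map_poly_comp; apply: eq_map_poly => x /=; rewrite ratr_int.
by rewrite -(dvdp_map (ratr : {rmorphism rat -> C})) !ratrE rmorphXn /= rE dvdpZl.
Qed.

(* D is a product of one P n for each point of s that is a root of some P n. *)
Lemma common_root_poly (C : numClosedFieldType) (F : fieldType) (P : nat -> {poly int})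
    (s : seq C) : (forall n, map_poly intr (P n) != 0 :> {poly F}) ->
  exists2 D : {poly int}, map_poly intr D != 0 :> {poly F} &
    forall n c, c \in s -> root (map_poly intr (P n)) c -> root (map_poly intr D) c.
Proof.
move=> P0; elim: s => [|c s [D D0 sD]].
  by exists 1; rewrite ?rmorph1 ?oner_eq0.
have [[n nc]|noc] := classic (exists n, root (map_poly intr (P n)) c).
  exists (P n * D); first by rewrite rmorphM mulf_neq0 /=.
  move=> k d; rewrite inE rmorphM rootM => /predU1P[-> _|ds kd]; first by rewrite nc.
  by rewrite (sD k) ?orbT.
exists D => // k d; rewrite inE => /predU1P[-> kc|]; last exact: sD.
by case: noc; exists k.
Qed.
End IntPolyReduction.

(** * Growth, cycles and the contradiction *)

Lemma expn_outgrows (a b d : nat) : (0 < a)%N -> (a < b)%N ->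
  exists n, (d * a ^ n < b ^ n)%N.
Proof.
(* Bernoulli's [(1 + 1/a)^n >= 1 + n/a], cleared of denominators; this [n] makes the bound
   [1 + d]. *)
move=> a0 ab; exists (d * a)%N.
have bern n : (a ^ n * (a + n) <= a * b ^ n)%N.
  elim: n => [|n IHn]; first by rewrite !expn0 addn0 mul1n muln1.
  apply: (@leq_trans (a * b ^ n * a.+1)%N); last first.
    by rewrite -mulnA leq_mul2l expnSr leq_mul2l ab !orbT.
  apply: leq_trans (leq_mul IHn (leqnn a.+1)).
  by rewrite expnSr -!mulnA leq_mul2l; apply/orP; right; nia.
have x0 : (0 < a ^ (d * a))%N by rewrite expn_gt0 a0.
have := bern (d * a)%N; rewrite -mulSn mulnA [leqLHS]mulnC leq_pmul2l // mulnC mulSn.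
by apply: leq_trans; rewrite -add1n leq_add2r.
Qed.

Lemma cycle_preperiodic_path (C : numClosedFieldType) (f g : {poly C}) n (z : nat -> C) :
    (0 < n)%N -> z n = z 0%N ->
    (forall k, (k < n)%N -> in_corr f g (z k.+1) (z k)) ->
  exists x, [/\ x 0%N = z 0%N, is_corr_path f g x & preperiodic_seq x].
Proof.
(* [z] lists the cycle backwards, so the path reads it by decreasing index; [zn] handles the
   wrap-around. *)
move=> n0 zn zE; exists (fun j => z (n - j %% n)%N); split.
- by rewrite mod0n subn0.
- move=> j; have jn : (j %% n < n)%N by rewrite ltn_pmod.
  have -> : (n - j %% n = (n - (j %% n).+1).+1)%N by lia.
  have -> : z (n - j.+1 %% n)%N = z (n - (j %% n).+1)%N.
    rewrite -addn1 -modnDml addn1; move: jn; rewrite leq_eqVlt => /predU1P[->|jn].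
      by rewrite modnn subn0 subnn.
    by rewrite modn_small.
  by apply: zE; lia.
exists 0%N, n; split; first by case: n n0 {zn zE}.
by move=> j; rewrite modnDl.
Qed.

(** Both derivatives can vanish only at 0, so a nonzero critical point has an edge to 0 and is
    prepended to the path. *)
Lemma constrained_of_cycle (C : numClosedFieldType) (p e : nat) (c : C) (x : nat -> C) :
    (1 < p)%N -> (0 < e)%N -> x 0%N = 0 ->
    is_corr_path ('X^p + c%:P) 'X^e x -> preperiodic_seq x ->
  postcritically_constrained ('X^p + c%:P) ('X^e).
Proof.
move=> p1 e0 x0 xP [i [j [ij xij]]] a.
have [-> _|a0] := eqVneq a 0; first by exists x; do !split => //; exists i, j.
case=> [|[b [ab]]].
  rewrite derivD derivC addr0 derivXn hornerMn hornerXn => /eqP.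
  rewrite -mulr_natr mulf_eq0 expf_eq0 (negPf a0) andbF pnatr_eq0 /=.
  by rewrite eqn0Ngt ltnW.
rewrite derivXn hornerMn hornerXn => /eqP.
rewrite -mulr_natr mulf_eq0 expf_eq0 pnatr_eq0 orbC eqn0Ngt e0 /= => /andP[_ /eqP b0].
exists (fun k => if k is k'.+1 then x k' else a); split=> //; split.
  by case=> [|k]; [rewrite x0 -b0 | apply: xP].
exists i.+1, j.+1; split=> [[]|k]; first exact: ij.
by rewrite !addSn.
Qed.

Theorem theorem1p4 (C : numClosedFieldType) (p e : nat) :
  prime p -> (1 <= e)%N -> (e < p)%N ->
  ~ (exists s : seq C, forall c : C,
       postcritically_constrained ('X^p + c%:P) ('X^e) -> c \in s).
Proof.
case: p => [|m] // p_pr e0 ep [s sP].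
have [F [iota _]] := countable_algebraic_closure 'F_m.+1.
have pF : m.+1 \in [pchar F] by rewrite (fmorph_pchar iota) pchar_Fp.
(* The shift to [n.+1] leaves out length 0, where the norm is identically 0. *)
pose P n := return_norm m e ('X : {poly int}) n.+1.
have redP (R : comNzRingType) n :
    map_poly intr (P n) = return_norm m e ('X : {poly R}) n.+1.
  by rewrite map_return_norm /= map_polyX.
have PF0 n : map_poly intr (P n) != 0 :> {poly F}.
  by rewrite redP return_norm_neq0.
have rootP n (c : C) : root (map_poly intr (P n)) c -> c \in s.
  rewrite redP rootE -horner_evalE map_return_norm /= horner_evalE hornerX.
  move=> /eqP/return_norm_eq0[z [z0 zn zE]]; apply: sP.
  have [|//|k kn|x [x0 xP xpre]] := @cycle_preperiodic_path _ ('X^(m.+1) + c%:P) ('X^e) n.+1 z.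
  - by [].
  - by rewrite z0 zn.
  - by rewrite /in_corr !hornerE zE.
  by apply: (constrained_of_cycle (prime_gt1 p_pr) e0 _ xP xpre); rewrite x0 z0.
have [D D0 sD] := common_root_poly s PF0.
(* [D] depends only on [s], so [n] may be chosen after it: the roots of [D], with multiplicity at
   most [e ^ n], cannot fill the degree [m.+1 ^ n]. *)
have [n] := expn_outgrows (size (map_poly intr D : {poly F})).-1 e0 ep.
apply/negP; rewrite -leqNgt.
have -> : (m.+1 ^ n = (size (map_poly intr (P n) : {poly F})).-1)%N.
  by rewrite redP size_return_norm.
have P0 : P n != 0 by apply: contraNneq (PF0 n) => ->; rewrite rmorph0.
have PD c : root (map_poly intr (P n)) c -> root (map_poly intr D : {poly C}) c.
  by move=> Pc; apply: (sD n) => //; apply: rootP Pc.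
have [k PDk] := dvdp_exp_roots P0 PD.
have Dk0 : map_poly intr (D ^+ k) != 0 :> {poly F} by rewrite rmorphXn expf_neq0.
have dvdF := dvdp_int_pchar pF PDk (PF0 n) Dk0.
apply: size_leq_mup => // x; last by rewrite redP mup_return_norm.
(* [D ^+ k] has the roots of [D], so [k], which varies with [n], does not enter the count. *)
move=> /(root_dvdp dvdF).
by rewrite rmorphXn rootE horner_exp expf_eq0 => /andP[_].
Qed.
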